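(* Let $(E,\phi)$ be any $t$-module over $K$ with $t$-motive $\mathcal{M}$. Then the map \[\hat H\to\mathrm{Hom}^\tau_{K[t]}(\mathcal{M},\mathbb{C}_\infty[[t]]),\qquad\sum_ie_it^i\mapsto\Bigl(m\mapsto\sum_im(e_i)t^i\Bigr)\] is an isomorphism of $\mathbb{F}_q[[t]]$-modules, and it restricts to an isomorphism of $\mathbb{F}_q[t]$-modules \[\iota:H\to\mathrm{Hom}^\tau_{K[t]}(\mathcal{M},\mathbb{T}).\]
   Context: $K$ finite extension of $\mathbb{F}_q(\theta)$, $|\theta|=q$, $\mathbb{C}_\infty$ completion of an algebraic closure of $K_\infty$, $\mathbb{T}\subseteq\mathbb{C}_\infty[[t]]$ the Tate algebra of series $\sum x_it^i$ with $|x_i|\to0$. On $\mathbb{C}_\infty[[t]]$, $\tau(\sum x_it^i)=\sum x_i^qt^i$. $(E,\phi)$ is a $t$-module over $K$ ($E\cong\mathbb{G}_{a,K}^d$, $\phi:\mathbb{F}_q[t]\to\mathrm{End}_{\mathrm{grp},\mathbb{F}_q}(E)$ an $\mathbb{F}_q$-algebra homomorphism with $d\phi_t-\theta$ nilpotent on $\mathrm{Lie}(E)$). Its $t$-motive is $\mathcal{M}=\mathrm{Hom}_{\mathrm{grp},\mathbb{F}_q}(E,\mathbb{G}_{a,K})$, a $K[t]$-module via $(c\,a)\cdot m=c\cdot(m\circ\phi_a)$ for $c\in K$, $a\in\mathbb{F}_q[t]$, with $\tau(m)=F\circ m$ where $F:x\mapsto x^q$ on $\mathbb{G}_a$. $\mathrm{Hom}^\tau_{K[t]}(\mathcal{M},R)$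 (for $R=\mathbb{C}_\infty[[t]]$ or $\mathbb{T}$) is the set of $K[t]$-linear maps $\mu$ with $\mu(\tau(m))=\tau(\mu(m))$ for all $m$; $\mathbb{F}_q[[t]]$ (resp. $\mathbb{F}_q[t]$) acts by multiplication of values. Fix coordinates on $E(\mathbb{C}_\infty)\cong\mathbb{C}_\infty^d$ with sup-norm $\|\cdot\|$. $E[[t]]$ = formal series $\sum_{i\ge0}e_it^i$, $e_i\in E(\mathbb{C}_\infty)$; $E\langle t\rangle$ those with $\|e_i\|\to0$. $\hat H=\{h\in E[[t]]\mid\phi_t(h)=h\cdot t\}$ ($\phi_t$ coefficientwise, $h\cdot t$ shift), $H=\hat H\cap E\langle t\rangle$; $\hat H$ is an $\mathbb{F}_q[[t]]$-module via multiplication of formal series with $\mathbb{F}_q$-coefficients. *)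

(* Defs.v *)
From HB Require Import structures.
From mathcomp Require Import all_boot all_order all_algebra all_field.
From mathcomp Require Import mpoly.
From mathcomp Require Import boolp classical_sets functions reals topology.
From mathcomp Require Import normedtype.

Set Implicit Arguments.
Unset Strict Implicit.
Unset Printing Implicit Defensive.

Import Order.TTheory GRing.Theory Num.Theory.
Import numFieldNormedType.Exports.

Local Open Scope classical_set_scope.
Local Open Scope ring_scope.

Record fps (A : Type) : Type := Fps { fps_coef :> nat -> A }.

Lemma fpsP (A : Type) (x y : fps A) : x =1 y -> x = y.
Proof. by case: x y => [x] [y] /= /funext ->. Qed.

HB.instance Definition _ (A : Type) := gen_eqMixin (fps A).
HB.instance Definition _ (A : Type) := gen_choiceMixin (fps A).

Section FpsZmod.
Variable A : zmodType.
Implicit Types x y z : fps A.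

Definition fps_zero : fps A := Fps (fun=> 0).
Definition fps_opp x : fps A := Fps (fun i => - x i).
Definition fps_add x y : fps A := Fps (fun i => x i + y i).

Fact fps_addA : associative fps_add.
Proof. by move=> x y z; apply: fpsP => i /=; rewrite addrA. Qed.
Fact fps_addC : commutative fps_add.
Proof. by move=> x y; apply: fpsP => i /=; rewrite addrC. Qed.
Fact fps_add0 : left_id fps_zero fps_add.
Proof. by move=> x; apply: fpsP => i /=; rewrite add0r. Qed.
Fact fps_addN : left_inverse fps_zero fps_opp fps_add.
Proof. by move=> x; apply: fpsP => i /=; rewrite addNr. Qed.

HB.instance Definition _ :=
  GRing.isZmodule.Build (fps A) fps_addA fps_addC fps_add0 fps_addN.

Lemma fps0E i : (0 : fps A) i = 0. Proof. by []. Qed.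
Lemma fpsDE x y i : (x + y) i = x i + y i. Proof. by []. Qed.
End FpsZmod.

(* The convolution [sum_(i + j = n) a_i *: v_j]; for [V := R^o] it is the
   multiplication of [R[[t]]], in general it makes [V[[t]]] a module over it. *)
Definition fps_conv (R : nzRingType) (V : lmodType R) (a : nat -> R)
    (v : nat -> V) (n : nat) : V :=
  \sum_(i < n.+1) a i *: v (n - i)%N.

Lemma fps_convA (R : nzRingType) (V : lmodType R) (a b : nat -> R)
    (v : nat -> V) n :
  fps_conv a (fps_conv b v) n = fps_conv (fps_conv (V := R^o) a b) v n.
Proof.
rewrite /fps_conv.
transitivity (\sum_(k < n.+1) \sum_(i < n.+1 | (i < k.+1)%N)
    (a i * b (k - i)%N) *: v (n - k)%N); last first.
  apply: eq_bigr => k _; rewrite scaler_suml.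
  by rewrite (big_ord_widen n.+1
    (fun i : nat => (a i *: (b (k - i)%N : R^o)) *: v (n - k)%N)).
rewrite (exchange_big_dep xpredT) //=; apply: eq_bigr => i _.
rewrite scaler_sumr -(big_mkord xpredT
  (fun j => a i *: (b j *: v (n - i - j)%N))).
rewrite -(big_geq_mkord i n.+1 xpredT
  (fun k => (a i * b (k - i)%N) *: v (n - k)%N)).
have := big_addn 0 n.+1 i xpredT (fun k => (a i * b (k - i)%N) *: v (n - k)%N).
rewrite add0n => ->; rewrite subSn; last by rewrite -ltnS.
by apply: eq_bigr => j _; rewrite addnK scalerA subnDA subnAC.
Qed.

Section FpsRing.
Variable R : comNzRingType.
Implicit Types x y z : fps R.

Definition fps_one : fps R := Fps (fun i => (i == 0)%:R).
Definition fps_mul x y : fps R := Fps (fps_conv (V := R^o) x y).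

Lemma fps_mulE x y n : fps_mul x y n = \sum_(i < n.+1) x i * y (n - i)%N.
Proof. by []. Qed.

Fact fps_mulA : associative fps_mul.
Proof. by move=> x y z; apply: fpsP => n; apply: (@fps_convA R R^o). Qed.
Fact fps_mulC : commutative fps_mul.
Proof.
move=> x y; apply: fpsP => n; rewrite !fps_mulE.
rewrite (reindex_inj rev_ord_inj) /=; apply: eq_bigr => i _.
by rewrite subSS subKn 1?mulrC // -ltnS.
Qed.
Fact fps_mul1 : left_id fps_one fps_mul.
Proof.
move=> x; apply: fpsP => n; rewrite fps_mulE big_ord_recl /= mul1r subn0.
by rewrite big1 ?addr0 // => i _; rewrite mul0r.
Qed.
Fact fps_mulDl : left_distributive fps_mul +%R.
Proof.
move=> x y z; apply: fpsP => n; rewrite fpsDE !fps_mulE -big_split /=.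
by apply: eq_bigr => i _; rewrite mulrDl.
Qed.
Fact fps_one_neq0 : fps_one != 0.
Proof.
apply/eqP => /(congr1 (fun x : fps R => x 0%N)) /= /eqP.
by rewrite oner_eq0.
Qed.

HB.instance Definition _ := GRing.Zmodule_isComNzRing.Build (fps R)
  fps_mulA fps_mulC fps_mul1 fps_mulDl fps_one_neq0.

Lemma fpsME x y n : (x * y) n = \sum_(i < n.+1) x i * y (n - i)%N.
Proof. by []. Qed.

Definition fps_t : fps R := Fps (fun i => (i == 1)%:R).

Definition fps_of_poly (p : {poly R}) : fps R := Fps (fun i => p`_i).

Fact fps_of_poly_zmod : zmod_morphism fps_of_poly.
Proof. by move=> p q; apply: fpsP => i /=; rewrite coefB. Qed.
Fact fps_of_poly_monoid : monoid_morphism fps_of_poly.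
Proof.
split; first by apply: fpsP => i /=; rewrite coef1.
by move=> p q; apply: fpsP => i; rewrite fpsME /= coefM.
Qed.
HB.instance Definition _ :=
  GRing.isZmodMorphism.Build {poly R} (fps R) fps_of_poly fps_of_poly_zmod.
HB.instance Definition _ :=
  GRing.isMonoidMorphism.Build {poly R} (fps R) fps_of_poly fps_of_poly_monoid.
End FpsRing.

Section FpsMod.
Variables (R : comNzRingType) (V : lmodType R).

Definition fps_scale (a : fps R) (v : fps V) : fps V := Fps (fps_conv a v).

Lemma fps_scaleE a v n :
  fps_scale a v n = \sum_(i < n.+1) a i *: v (n - i)%N.
Proof. by []. Qed.

Fact fps_scaleA a b v : fps_scale a (fps_scale b v) = fps_scale (a * b) v.
Proof. by apply: fpsP => n; apply: fps_convA. Qed.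
Fact fps_scale1 : left_id 1 fps_scale.
Proof.
move=> x; apply: fpsP => n; rewrite fps_scaleE big_ord_recl /= scale1r subn0.
by rewrite big1 ?addr0 // => i _; rewrite scale0r.
Qed.
Fact fps_scaleDr : right_distributive fps_scale +%R.
Proof.
move=> x y z; apply: fpsP => n; rewrite fpsDE !fps_scaleE -big_split /=.
by apply: eq_bigr => i _; rewrite scalerDr.
Qed.
Fact fps_scaleDl v : {morph fps_scale^~ v : a b / a + b}.
Proof.
move=> x y; apply: fpsP => n; rewrite fpsDE !fps_scaleE -big_split /=.
by apply: eq_bigr => i _; rewrite scalerDl.
Qed.

HB.instance Definition _ := GRing.Zmodule_isLmodule.Build (fps R) (fps V)
  fps_scaleA fps_scale1 fps_scaleDr fps_scaleDl.

Lemma fpsZE (a : fps R) (v : fps V) n :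
  (a *: v) n = \sum_(i < n.+1) a i *: v (n - i)%N.
Proof. by []. Qed.

Lemma fps_tZE (v : fps V) n :
  (fps_t R *: v) n = if n is m.+1 then v m else 0.
Proof.
rewrite fpsZE; case: n => [|n]; first by rewrite big_ord1 scale0r.
rewrite big_ord_recl scale0r add0r big_ord_recl /= scale1r subSS subn0.
by rewrite big1 ?addr0 // => i _; rewrite scale0r.
Qed.
End FpsMod.

Section FpsMap.
Variables (R S : comNzRingType) (f : {rmorphism R -> S}).

Definition fps_map (x : fps R) : fps S := Fps (fun i => f (x i)).

Fact fps_map_zmod : zmod_morphism fps_map.
Proof. by move=> x y; apply: fpsP => i /=; rewrite rmorphB. Qed.
Fact fps_map_monoid : monoid_morphism fps_map.
Proof.
split; first by apply: fpsP => i /=; rewrite rmorph_nat.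
move=> x y; apply: fpsP => n; rewrite fpsME /= rmorph_sum /=.
by apply: eq_bigr => i _; rewrite rmorphM.
Qed.
HB.instance Definition _ :=
  GRing.isZmodMorphism.Build (fps R) (fps S) fps_map fps_map_zmod.
HB.instance Definition _ :=
  GRing.isMonoidMorphism.Build (fps R) (fps S) fps_map fps_map_monoid.
End FpsMap.

Definition restr (R S : nzRingType) (f : {rmorphism R -> S})
  (V : lmodType S) : Type := V.

Section Restr.
Variables (R S : nzRingType) (f : {rmorphism R -> S}) (V : lmodType S).

HB.instance Definition _ := GRing.Zmodule.on (restr f V).

Definition restr_scale (a : R) (v : restr f V) : restr f V := f a *: (v : V).

Fact restr_scaleA a b v :
  restr_scale a (restr_scale b v) = restr_scale (a * b) v.
Proof. by rewrite /restr_scale rmorphM scalerA. Qed.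
Fact restr_scale1 : left_id 1 restr_scale.
Proof. by move=> v; rewrite /restr_scale rmorph1 scale1r. Qed.
Fact restr_scaleDr : right_distributive restr_scale +%R.
Proof. by move=> a u v; rewrite /restr_scale scalerDr. Qed.
Fact restr_scaleDl v : {morph restr_scale^~ v : a b / a + b}.
Proof. by move=> a b; rewrite /restr_scale rmorphD scalerDl. Qed.
HB.instance Definition _ := GRing.Zmodule_isLmodule.Build R (restr f V)
  restr_scaleA restr_scale1 restr_scaleDr restr_scaleDl.

Lemma restrZE (a : R) (v : restr f V) : a *: v = f a *: (v : V).
Proof. by []. Qed.
End Restr.

Record absval (R : realType) (K : fieldType) := AbsVal {
  absv :> K -> R;
  absv_ge0 : forall x, 0 <= absv x;
  absv_eq0 : forall x, absv x = 0 <-> x = 0;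
  absvM : forall x y, absv (x * y) = absv x * absv y;
  absv_ultra : forall x y, absv (x + y) <= Num.max (absv x) (absv y) }.

Definition absval_cauchy (R : realType) (K : fieldType) (v : absval R K)
    (u : nat -> K) : Prop :=
  forall e : R, 0 < e -> exists N, forall m n,
    (N <= m)%N -> (N <= n)%N -> v (u m - u n) < e.

Record is_completion (R : realType) (K L : fieldType) (vK : absval R K)
    (vL : absval R L) (f : {rmorphism K -> L}) : Prop := IsCompletion {
  completion_isometry : forall x, vL (f x) = vK x;
  completion_dense : forall (y : L) (e : R), 0 < e -> exists x, vL (y - f x) < e;
  completion_complete : forall u : nat -> L, absval_cauchy vL u ->
    exists l : L, (fun n => vL (u n - l)) @ \oo --> (0 : R) }.

Section FunctionField.
Variables (F : finFieldType) (K : fieldExtType {fraction {poly F}}).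

Definition theta : K := (tofrac ('X : {poly F}))%:A.

Definition FtoK : F -> K := fun c => (tofrac (c%:P : {poly F}))%:A.

Fact FtoK_zmod : zmod_morphism FtoK.
Proof. by move=> a b; rewrite /FtoK polyCB rmorphB scalerBl. Qed.
Fact FtoK_monoid : monoid_morphism FtoK.
Proof.
split; first by rewrite /FtoK !rmorph1 scale1r.
by move=> a b; rewrite /FtoK polyCM rmorphM -scalerAl mul1r scalerA.
Qed.
HB.instance Definition _ := GRing.isZmodMorphism.Build F K FtoK FtoK_zmod.
HB.instance Definition _ := GRing.isMonoidMorphism.Build F K FtoK FtoK_monoid.

(* The tower [K -> K_oo -> Kbar -> C_oo].  An absolute value on [F_q(theta)]
   is determined by [|theta| = q], so [Kabs] is an extension to [K] of the
   usual one, i.e. the choice of an infinite place of [K]. *)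
Record infinite_place (R : realType) := InfinitePlace {
  Kabs : absval R K;
  Kabs_theta : Kabs theta = #|F|%:R;
  Kinf : fieldType;
  Kinf_abs : absval R Kinf;
  K_Kinf : {rmorphism K -> Kinf};
  Kinf_completion : is_completion Kabs Kinf_abs K_Kinf;
  Kbar : closedFieldType;
  Kbar_abs : absval R Kbar;
  Kinf_Kbar : {rmorphism Kinf -> Kbar};
  Kbar_algebraic : forall x, algebraicOver Kinf_Kbar x;
  Kbar_isometry : forall x, Kbar_abs (Kinf_Kbar x) = Kinf_abs x;
  Cinf : fieldType;
  Cabs : absval R Cinf;
  Kbar_Cinf : {rmorphism Kbar -> Cinf};
  Cinf_completion : is_completion Kbar_abs Cabs Kbar_Cinf }.

Section Emb.
Variables (R : realType) (P : infinite_place R).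
Definition KtoC : {rmorphism K -> Cinf P} :=
  (@Kbar_Cinf R P \o (@Kinf_Kbar R P \o @K_Kinf R P))%FUN.
Definition FtoC : {rmorphism F -> Cinf P} := (KtoC \o FtoK)%FUN.
End Emb.

(* value of the morphism [m : G_a^d -> G_a] at an [A]-valued point, [A] being
   the [K]-algebra with structure map [f] *)
Definition pt (d : nat) (A : comNzRingType) (f : {rmorphism K -> A})
  (m : {mpoly K[d]}) (x : 'rV[A]_d) : A := mmap f (x 0) m.

(* A morphism of schemes [G_a^d -> G_a] is a polynomial; it is a homomorphism
   of group schemes compatible with the action of [F_q] iff it induces
   [F_q]-linear maps on [A]-valued points for all [K]-algebras [A]. *)
Definition Ga_hom (d : nat) (m : {mpoly K[d]}) : Prop :=
  forall (A : comNzRingType) (f : {rmorphism K -> A}),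
    {morph pt f m : x y / x + y} /\
    (forall (c : F) (x : 'rV[A]_d),
       pt f m (f (FtoK c) *: x) = f (FtoK c) * pt f m x).

Definition pts (d : nat) (A : comNzRingType) (f : {rmorphism K -> A})
  (g : d.-tuple {mpoly K[d]}) (x : 'rV[A]_d) : 'rV[A]_d :=
  \row_i pt f (tnth g i) x.

Definition Lie_mx (d : nat) (g : d.-tuple {mpoly K[d]}) : 'M[K]_d :=
  \matrix_(i, j) ((tnth g i)^`M(j)).@[fun=> 0].

Record tmodule (d : nat) := TModule {
  phi : {poly F} -> d.-tuple {mpoly K[d]};
  phi_hom : forall a i, Ga_hom (tnth (phi a) i);
  phiD : forall a b i,
    tnth (phi (a + b)) i = tnth (phi a) i + tnth (phi b) i;
  phiM : forall a b i, tnth (phi (a * b)) i = tnth (phi a) i \mPo phi b;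
  phiC : forall (c : F) i, tnth (phi c%:P) i = FtoK c *: 'X_i;
  phi_Lie : exists n, (Lie_mx (phi 'X) - theta%:M) ^+ n = 0 }.

Section GaHomClosure.
Variable d : nat.

Definition Ga_hom_pred : {pred {mpoly K[d]}} := fun m => `[< Ga_hom m >].

Lemma pt_comp (A : comNzRingType) (f : {rmorphism K -> A})
    (m : {mpoly K[d]}) (g : d.-tuple {mpoly K[d]}) x :
  pt f (m \mPo g) x = pt f m (pts f g x).
Proof.
rewrite /pt comp_mpolyEX rmorph_sum /= /mmap.
apply: eq_bigr => w _; rewrite -/(mmap _ _ _) mmapZ; congr (_ * _).
rewrite comp_mpolyX rmorph_prod /=; apply: eq_bigr => i _.
by rewrite rmorphXn /= mxE.
Qed.

Fact Ga_hom_zmod_closed : zmod_closed Ga_hom_pred.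
Proof.
split.
  apply/asboolP => A f; split=> [x y|c x]; rewrite /pt !mmap0 ?addr0 //.
  by rewrite mulr0.
move=> m n /asboolP hm /asboolP hn; apply/asboolP => A f.
have [mD mZ] := hm A f; have [nD nZ] := hn A f.
rewrite /pt in mD mZ nD nZ *; split=> [x y|c x]; rewrite !mmapB.
  by rewrite mD nD opprD addrACA.
by rewrite mZ nZ mulrBr.
Qed.
HB.instance Definition _ :=
  GRing.isZmodClosed.Build {mpoly K[d]} Ga_hom_pred Ga_hom_zmod_closed.

Lemma Ga_homZ (c : K) (m : {mpoly K[d]}) : Ga_hom m -> Ga_hom (c *: m).
Proof.
move=> hm A f; have [mD mZ] := hm A f; rewrite /pt in mD mZ *.
split=> [x y|a x]; rewrite !mmapZ; first by rewrite mD mulrDr.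
by rewrite mZ mulrCA.
Qed.

Lemma Ga_hom_comp (m : {mpoly K[d]}) (g : d.-tuple {mpoly K[d]}) :
  Ga_hom m -> (forall i, Ga_hom (tnth g i)) -> Ga_hom (m \mPo g).
Proof.
move=> hm hg A f; have [mD mZ] := hm A f.
split=> [x y|c x]; rewrite !pt_comp.
  rewrite -mD; congr pt; apply/rowP => i; rewrite !mxE.
  by have [-> _] := hg i A f.
rewrite -mZ; congr pt; apply/rowP => i; rewrite !mxE.
by have [_ ->] := hg i A f.
Qed.

Lemma pchar_nat_card (A : comNzRingType) (f : {rmorphism F -> A}) :
  [pchar A].-nat #|F|.
Proof.
have [p p_pr pF] := finPcharP F.
rewrite (card_pprimeChar pF).
rewrite pnatX; apply/orP; left.
by rewrite pnatE // (rmorph_pchar f).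
Qed.

Lemma Ga_hom_Frob (m : {mpoly K[d]}) : Ga_hom m -> Ga_hom (m ^+ #|F|).
Proof.
move=> hm A f; have [mD mZ] := hm A f; rewrite /pt in mD mZ *.
split=> [x y|c x]; rewrite !rmorphXn /=.
  by rewrite mD exprDn_pchar // (@pchar_nat_card A (f \o FtoK)%FUN).
by rewrite mZ exprMn -!rmorphXn /= expf_card.
Qed.
End GaHomClosure.

(* indexed by [E] because the [K[t]]-module structure depends on [phi] *)
Record tmotive (d : nat) (E : tmodule d) := TMotive {
  tmotive_val :> {mpoly K[d]};
  _ : tmotive_val \in @Ga_hom_pred d }.

Section Motive.
Variables (d : nat) (E : tmodule d).

HB.instance Definition _ := [isSub for @tmotive_val d E].
HB.instance Definition _ := [Choice of tmotive E by <:].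
HB.instance Definition _ := [SubChoice_isSubZmodule of tmotive E by <:].

Implicit Types (m : tmotive E) (f g : {poly K}).

Lemma tmotiveP m : Ga_hom m. Proof. by case: m => m /= /asboolP. Qed.

Lemma tmotive_inP (p : {mpoly K[d]}) : Ga_hom p -> p \in @Ga_hom_pred d.
Proof. by move=> ?; apply/asboolP. Qed.

Definition tmotive_Kscale (c : K) m : tmotive E :=
  TMotive E (tmotive_inP (Ga_homZ c (tmotiveP m))).

Definition tmotive_comp (a : {poly F}) m : tmotive E :=
  TMotive E (tmotive_inP (Ga_hom_comp (tmotiveP m) (@phi_hom d E a))).

(* [(sum_i f_i t^i) . m = sum_i f_i . (m o phi_(t^i))] *)
Definition tmotive_scale (f : {poly K}) m : tmotive E :=
  \sum_(i < size f) tmotive_Kscale f`_i (tmotive_comp 'X^i m).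

Definition tmotive_tau m : tmotive E :=
  TMotive E (tmotive_inP (Ga_hom_Frob (tmotiveP m))).

Lemma tmotive_valD : {morph @tmotive_val d E : x y / x + y}. Proof. by []. Qed.
Lemma tmotive_val0 : @tmotive_val d E 0 = 0. Proof. by []. Qed.

Lemma comp_phi1 (p : {mpoly K[d]}) : p \mPo phi E 1 = p.
Proof.
rewrite -[RHS]comp_mpoly_id; congr comp_mpoly; apply: eq_from_tnth => i.
by rewrite tnth_mktuple -polyC1 phiC rmorph1 scale1r.
Qed.

Lemma comp_phiM (p : {mpoly K[d]}) a b :
  p \mPo phi E (a * b) = (p \mPo phi E a) \mPo phi E b.
Proof.
rewrite comp_mpolyEX [p \mPo phi E a]comp_mpolyEX raddf_sum /=.
apply: eq_bigr => w _.
rewrite comp_mpolyZ; congr (_ *: _); rewrite !comp_mpolyX rmorph_prod /=.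
by apply: eq_bigr => i _; rewrite rmorphXn /= phiM.
Qed.

Lemma tmotive_scaleE f m N : (size f <= N)%N ->
  tmotive_val (tmotive_scale f m) =
  \sum_(i < N) f`_i *: (tmotive_val m \mPo phi E 'X^i).
Proof.
move=> fN; rewrite /tmotive_scale (big_morph _ tmotive_valD tmotive_val0) /=.
rewrite (big_ord_widen N (fun i : nat => f`_i *: (tmotive_val m \mPo phi E 'X^i))) //.
rewrite big_mkcond /=; apply: eq_bigr => i _; case: ifPn => //.
by rewrite -leqNgt => /(nth_default 0) ->; rewrite scale0r.
Qed.

Fact tmotive_scaleDr : right_distributive tmotive_scale +%R.
Proof.
move=> f m n; apply: val_inj; rewrite /= !(tmotive_scaleE _ (leqnn _)).
rewrite -big_split /=; apply: eq_bigr => i _.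
by rewrite comp_mpolyD scalerDr.
Qed.
Fact tmotive_scaleDl m : {morph tmotive_scale^~ m : f g / f + g}.
Proof.
move=> f g; apply: val_inj => /=.
pose N := maxn (size f) (size g).
rewrite (@tmotive_scaleE (f + g) m N) ?size_polyD //.
rewrite (@tmotive_scaleE f m N) ?leq_maxl //.
rewrite (@tmotive_scaleE g m N) ?leq_maxr //.
by rewrite -big_split /=; apply: eq_bigr => i _; rewrite coefD scalerDl.
Qed.
Lemma tmotive_scaleC c m : tmotive_scale c%:P m = tmotive_Kscale c m.
Proof.
apply: val_inj; rewrite /= (@tmotive_scaleE _ m 1) ?size_polyC_leq1 //.
by rewrite big_ord1 coefC eqxx expr0 comp_phi1.
Qed.
Fact tmotive_scale1 : left_id 1 tmotive_scale.
Proof.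
by move=> m; rewrite -polyC1 tmotive_scaleC; apply: val_inj; rewrite /= scale1r.
Qed.
Lemma tmotive_scaleMX f m :
  tmotive_scale (f * 'X) m = tmotive_comp 'X (tmotive_scale f m).
Proof.
apply: val_inj; rewrite /= (@tmotive_scaleE _ m (size f).+1); last first.
  by have [->|f0] := eqVneq f 0; rewrite ?mul0r ?size_poly0 // size_mulX.
rewrite (tmotive_scaleE _ (leqnn _)) big_ord_recl coefMX scale0r add0r.
rewrite raddf_sum /=; apply: eq_bigr => i _.
by rewrite coefMX /= comp_mpolyZ -comp_phiM -exprSr.
Qed.
Lemma tmotive_scaleXc f m :
  tmotive_scale f (tmotive_comp 'X m) = tmotive_comp 'X (tmotive_scale f m).
Proof.
rewrite -tmotive_scaleMX; apply: val_inj.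
rewrite /= (@tmotive_scaleE (f * 'X) m (size f).+1); last first.
  by have [->|f0] := eqVneq f 0; rewrite ?mul0r ?size_poly0 // size_mulX.
rewrite (tmotive_scaleE _ (leqnn _)) big_ord_recl coefMX scale0r add0r.
by apply: eq_bigr => i _; rewrite coefMX /= -comp_phiM -exprS.
Qed.
Fact tmotive_scaleA f g m :
  tmotive_scale f (tmotive_scale g m) = tmotive_scale (f * g) m.
Proof.
elim/poly_ind: f => [|f c IH].
  rewrite mul0r; apply: val_inj.
  by rewrite /= !(@tmotive_scaleE 0 _ 0) ?size_poly0 // !big_ord0.
rewrite tmotive_scaleDl tmotive_scaleMX IH mulrDl tmotive_scaleDl mulrAC tmotive_scaleMX; congr (_ + _).
rewrite tmotive_scaleC; apply: val_inj => /=.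
rewrite (tmotive_scaleE _ (leqnn _)) (@tmotive_scaleE _ m (size g)); last first.
  by rewrite mul_polyC size_scale_leq.
rewrite scaler_sumr; apply: eq_bigr => i _.
by rewrite mul_polyC coefZ scalerA.
Qed.

HB.instance Definition _ := GRing.Zmodule_isLmodule.Build {poly K} (tmotive E)
  tmotive_scaleA tmotive_scale1 tmotive_scaleDr tmotive_scaleDl.

(* the defining formula [(c a) . m = c . (m o phi_a)] *)
Lemma tmotive_scale_phi (c : K) (a : {poly F}) m :
  tmotive_val ((c *: map_poly FtoK a) *: m)
  = c *: (tmotive_val m \mPo phi E a).
Proof.
have comp_row (w : d.-tuple {mpoly K[d]}) : tmotive_val m \mPo w =
    pt (@mpolyC d K) (tmotive_val m) (\row_i tnth w i).
  rewrite /comp_mpoly /pt; apply: eq_bigr => u _; congr (_ * _).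
  by apply: mmap1_eq => i; rewrite mxE.
have compD b1 b2 :
    tmotive_comp (b1 + b2) m = tmotive_comp b1 m + tmotive_comp b2 m.
  apply: val_inj; rewrite /= !comp_row.
  have [<- _] := tmotiveP m (@mpolyC d K).
  by congr pt; apply/rowP => i; rewrite !mxE phiD.
rewrite -mul_polyC -scalerA [c%:P *: _]tmotive_scaleC /=; congr (_ *: _).
suff -> : map_poly FtoK a *: m = tmotive_comp a m by [].
elim/poly_ind: a => [|a b IH].
  rewrite rmorph0 scale0r; apply: (addrI (tmotive_comp 0 m)).
  by rewrite -compD !addr0.
rewrite compD rmorphD rmorphM /= map_polyX map_polyC scalerDl mulrC; congr (_ + _).
  rewrite [X in _ *: X]/= -scalerA IH.
  have -> : 'X *: tmotive_comp a m = tmotive_comp 'X (tmotive_comp a m).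
    rewrite -[X in X *: _]mul1r [LHS]tmotive_scaleMX; congr tmotive_comp.
    exact: tmotive_scale1.
  by apply: val_inj; rewrite /= -comp_phiM mulrC.
rewrite [LHS]tmotive_scaleC; apply: val_inj; rewrite /= comp_row /=.
have [_ mZ] := tmotiveP m (@mpolyC d K).
have -> : \row_i tnth (phi E b%:P) i = mpolyC d (FtoK b) *: \row_i 'X_i :> 'rV_d.
  by apply/rowP => i; rewrite !mxE phiC mul_mpolyC.
rewrite mZ mul_mpolyC; congr (_ *: _).
rewrite -[LHS]comp_mpoly_id comp_row; congr pt; apply/rowP => i.
by rewrite !mxE tnth_mktuple.
Qed.
End Motive.

Section Points.
Variables (R : realType) (P : infinite_place R) (d : nat) (E : tmodule d).
Local Notation C := (Cinf P).

Definition FttoCtt : {rmorphism fps F -> fps C} := fps_map (FtoC P).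

(* [E[[t]]], with scalars restricted along [F_q[[t]] -> C_oo[[t]]] *)
Definition Eser : Type := restr FttoCtt (fps 'rV[C]_d).
HB.instance Definition _ := GRing.Lmodule.on Eser.

Definition supnorm (x : 'rV[C]_d) : R := \big[Num.max/0]_(i < d) Cabs P (x 0 i).

Definition null_fps (V : Type) (N : V -> R) (x : fps V) : Prop :=
  (fun i => N (x i)) @ \oo --> (0 : R).

Definition phi_ser (a : {poly F}) (h : Eser) : Eser :=
  Fps (fun i => pts (KtoC P) (phi E a) ((h : fps _) i)).

(* multiplication by [fps_t F] is the shift [h . t], see [fps_tZE] *)
Definition Hhat_pred : {pred Eser} :=
  fun h => `[< phi_ser 'X h = fps_t F *: h >].

Lemma pts_linear (a : {poly F}) (c : F) (x y : 'rV[C]_d) :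
  pts (KtoC P) (phi E a) (FtoC P c *: x + y) =
  FtoC P c *: pts (KtoC P) (phi E a) x + pts (KtoC P) (phi E a) y.
Proof.
apply/rowP => i; rewrite !mxE.
by have [-> ->] := @phi_hom d E a i C (KtoC P).
Qed.

Lemma EserZE (a : fps F) (h : Eser) n :
  (a *: h : fps _) n = \sum_(i < n.+1) FtoC P (a i) *: (h : fps _) (n - i)%N.
Proof. by []. Qed.

Fact phi_ser_linear (a : {poly F}) : linear (phi_ser a).
Proof.
pose g := pts (KtoC P) (phi E a).
have gD x y : g (x + y) = g x + g y.
  by have := pts_linear a 1 x y; rewrite rmorph1 !scale1r.
have gZ c x : g (FtoC P c *: x) = FtoC P c *: g x.
  have g0 : g 0 = 0 by apply: (addrI (g 0)); rewrite -gD !addr0.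
  by have := pts_linear a c x 0; rewrite -/g g0 !addr0.
move=> b h1 h2; apply: fpsP => n /=; rewrite -/g.
rewrite [LHS]gD; congr (_ + _); rewrite /fps_conv.
elim/big_ind2: _ => [|x1 y1 x2 y2 <- <-|i _]; rewrite ?gZ ?gD //.
by apply: (addrI (g 0)); rewrite -gD !addr0.
Qed.

Fact Hhat_closed : submod_closed Hhat_pred.
Proof.
have phi0 : phi_ser 'X 0 = 0.
  have := phi_ser_linear 'X 1 0 0; rewrite !scale1r !addr0 => e.
  by apply: (addrI (phi_ser 'X 0)); rewrite addr0 -e.
split; first by apply/asboolP; rewrite phi0 scaler0.
move=> a u v /asboolP hu /asboolP hv; apply/asboolP.
by rewrite phi_ser_linear hu hv scalerDr !scalerA mulrC.
Qed.
HB.instance Definition _ :=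
  GRing.isSubmodClosed.Build (fps F) Eser Hhat_pred Hhat_closed.

Record Hhat : Type := HhatElt { Hhat_val :> Eser; _ : Hhat_val \in Hhat_pred }.
HB.instance Definition _ := [isSub for Hhat_val].
HB.instance Definition _ := [Choice of Hhat by <:].
HB.instance Definition _ := [SubChoice_isSubLmodule of Hhat by <:].

Definition Hhat_t : Type := restr (@fps_of_poly F) Hhat.
HB.instance Definition _ := GRing.Lmodule.on Hhat_t.

Definition H_pred : {pred Hhat_t} :=
  fun h => `[< null_fps supnorm (Hhat_val h) >].

Definition Ctt : Type := restr FttoCtt (fps C)^o.
HB.instance Definition _ := GRing.Lmodule.on Ctt.

Definition KtToCtt (f : {poly K}) : fps C := fps_of_poly (map_poly (KtoC P) f).

Definition tau_ser (x : fps C) : fps C := Fps (fun i => x i ^+ #|F|).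

Definition Tate (x : fps C) : Prop := null_fps (Cabs P) x.

Definition HomCtt_pred : {pred tmotive E -> Ctt} := fun mu =>
  `[< (forall (f : {poly K}) (m1 m2 : tmotive E),
         mu (f *: m1 + m2) = KtToCtt f * (mu m1 : fps C) + mu m2 :> fps C) /\
      (forall m : tmotive E, mu (tmotive_tau m) = tau_ser (mu m) :> fps C) >].

Fact tau_serD : {morph tau_ser : x y / x + y}.
Proof.
move=> x y; apply: fpsP => i /=.
exact/exprDn_pchar/(pchar_nat_card (FtoC P)).
Qed.

Fact tau_ser0 : tau_ser 0 = 0.
Proof.
by apply: (addrI (tau_ser 0)); rewrite -tau_serD !addr0.
Qed.

Fact tau_serZ (a : fps F) (x : fps C) :
  tau_ser (FttoCtt a * x) = FttoCtt a * tau_ser x.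
Proof.
apply: fpsP => n; change ((FttoCtt a * x) n ^+ #|F| = (FttoCtt a * tau_ser x) n).
rewrite !fpsME.
elim/big_ind2: _ => [|x1 y1 x2 y2 <- <-|i _] /=.
- by rewrite expr0n gtn_eqF // (ltn_trans _ (finNzRing_gt1 F)).
- exact/exprDn_pchar/(pchar_nat_card (FtoC P)).
by rewrite exprMn -(rmorphXn (FtoC P)) expf_card.
Qed.

Fact HomCtt_closed : submod_closed HomCtt_pred.
Proof.
split.
  apply/asboolP; split=> [f m1 m2|m]; first by rewrite mulr0 addr0.
  by rewrite [RHS]tau_ser0.
move=> a u v /asboolP[uD ut] /asboolP[vD vt]; apply/asboolP.
split=> [f m1 m2|m].
  change (FttoCtt a * (u (f *: m1 + m2) : fps C) + v (f *: m1 + m2) =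
    KtToCtt f * (FttoCtt a * (u m1 : fps C) + v m1) +
    (FttoCtt a * (u m2 : fps C) + v m2)).
  by rewrite uD vD !mulrDr mulrCA addrACA.
change (FttoCtt a * (u (tmotive_tau m) : fps C) + v (tmotive_tau m) =
  tau_ser (FttoCtt a * (u m : fps C) + v m)).
by rewrite tau_serD tau_serZ ut vt.
Qed.
HB.instance Definition _ := GRing.isSubmodClosed.Build (fps F)
  (tmotive E -> Ctt) HomCtt_pred HomCtt_closed.

Record HomCtt : Type :=
  HomCttElt { HomCtt_val :> tmotive E -> Ctt; _ : HomCtt_val \in HomCtt_pred }.
HB.instance Definition _ := [isSub for HomCtt_val].
HB.instance Definition _ := [Choice of HomCtt by <:].
HB.instance Definition _ := [SubChoice_isSubLmodule of HomCtt by <:].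

Definition HomCtt_t : Type := restr (@fps_of_poly F) HomCtt.
HB.instance Definition _ := GRing.Lmodule.on HomCtt_t.

(* [K[t]]-linear [tau]-equivariant maps to [T], viewed as maps to [C_oo[[t]]] *)
Definition HomT_pred : {pred HomCtt_t} :=
  fun mu => `[< forall m, Tate (HomCtt_val mu m) >].

Lemma null_fpsP (V : Type) (N : V -> R) (x : fps V) : (forall v, 0 <= N v) ->
  null_fps N x <->
  (forall e, 0 < e -> exists n0, forall n, (n0 <= n)%N -> N (x n) < e).
Proof.
move=> N0; split=> [/cvgr0Pnorm_lt h e e0|h].
  have [n0 _ hn] := h e e0; exists n0 => n /hn.
  by rewrite /= ger0_norm.
apply/cvgr0Pnorm_lt => e e0; have [n0 hn] := h e e0; exists n0 => // n /= /hn.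
by rewrite ger0_norm.
Qed.

Lemma null_fps_submod (V : lmodType C) (N : V -> R) (p : {poly F})
    (x y : fps V) :
  (forall v, 0 <= N v) -> (forall v w, N (v + w) <= Num.max (N v) (N w)) ->
  (forall c v, N (c *: v) <= Cabs P c * N v) ->
  null_fps N x -> null_fps N y ->
  null_fps N (FttoCtt (fps_of_poly p) *: x + y).
Proof.
move=> N0 ND NZ nx ny.
have nD z w : null_fps N z -> null_fps N w -> null_fps N (z + w).
  move=> /(null_fpsP _ N0) hz /(null_fpsP _ N0) hw.
  apply/(null_fpsP _ N0) => e e0.
  have [n1 h1] := hz e e0; have [n2 h2] := hw e e0.
  exists (maxn n1 n2) => n; rewrite geq_max => /andP[/h1 ? /h2 ?].
  by rewrite (le_lt_trans (ND _ _)) // gt_max; apply/andP.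
apply: (nD) => //; elim/poly_ind: p => [|p c IH].
  rewrite !rmorph0 scale0r; apply/(null_fpsP _ N0) => e e0.
  exists 0%N => n _; have := NZ 0 0; rewrite scale0r.
  have /absv_eq0 -> : (0 : C) = 0 by [].
  by rewrite mul0r => /le_lt_trans; apply.
rewrite rmorphD rmorphD scalerDl; apply: (nD).
  rewrite mulrC !rmorphM -scalerA.
  set z := _ *: x in IH *.
  have -> : FttoCtt (fps_of_poly 'X) = fps_t C.
    by apply: fpsP => i; rewrite [LHS](_ : _ = FtoC P 'X`_i) // coefX rmorph_nat.
  move/(null_fpsP _ N0): IH => IH.
  apply/(null_fpsP _ N0) => e /IH[n0 hn].
  by exists n0.+1; case=> // n hn0; rewrite fps_tZE hn.
have cE n : (FttoCtt (fps_of_poly c%:P) *: x) n = FtoC P c *: x n.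
  have pE i : FttoCtt (fps_of_poly c%:P) i = FtoC P c%:P`_i by [].
  rewrite fpsZE big_ord_recl pE coefC eqxx subn0 big1 ?addr0 // => i _.
  by rewrite pE coefC rmorph0 scale0r.
move/(null_fpsP _ N0): nx => nx; apply/(null_fpsP _ N0) => e e0.
have c0 : 0 < Cabs P (FtoC P c) + 1 by rewrite ltr_wpDl // absv_ge0.
have [n0 hn] := nx _ (divr_gt0 e0 c0); exists n0 => n /hn; rewrite cE.
rewrite ltr_pdivlMr // => /(le_lt_trans _); apply; rewrite (le_trans (NZ _ _)) //.
by rewrite mulrC ler_wpM2l // lerDl.
Qed.

Lemma supnorm_ge0 x : 0 <= supnorm x.
Proof. exact: bigmax_ge_id. Qed.

Lemma supnormD x y : supnorm (x + y) <= Num.max (supnorm x) (supnorm y).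
Proof.
apply: bigmax_le => [|i _]; first by rewrite le_max supnorm_ge0.
rewrite mxE (le_trans (absv_ultra _ _ _)) // ge_max !le_max.
by apply/andP; split; apply/orP; [left|right]; apply: le_bigmax.
Qed.

Lemma supnormZ c x : supnorm (c *: x) <= Cabs P c * supnorm x.
Proof.
apply: bigmax_le => [|i _]; first by rewrite mulr_ge0 ?absv_ge0 ?supnorm_ge0.
by rewrite mxE absvM ler_wpM2l ?absv_ge0 //; apply: le_bigmax.
Qed.

Fact H_closed : submod_closed H_pred.
Proof.
split.
  apply/asboolP/(null_fpsP _ supnorm_ge0) => e e0; exists 0%N => n _.
  rewrite (le_lt_trans _ e0) //; apply: bigmax_le => // i _.
  by rewrite mxE; have /absv_eq0 -> : (0 : C) = 0 by [].
move=> a u v /asboolP hu /asboolP hv; apply/asboolP.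
exact: (null_fps_submod a supnorm_ge0 supnormD supnormZ hu hv).
Qed.
HB.instance Definition _ :=
  GRing.isSubmodClosed.Build {poly F} Hhat_t H_pred H_closed.

Record H : Type := HElt { H_val :> Hhat_t; _ : H_val \in H_pred }.
HB.instance Definition _ := [isSub for H_val].
HB.instance Definition _ := [Choice of H by <:].
HB.instance Definition _ := [SubChoice_isSubLmodule of H by <:].

Fact HomT_closed : submod_closed HomT_pred.
Proof.
have C0 := @absv_ge0 R C (Cabs P).
split.
  apply/asboolP => m; apply/(null_fpsP _ C0) => e e0; exists 0%N => n _.
  by have /absv_eq0 -> : (0 : C) = 0 by [].
move=> a u v /asboolP hu /asboolP hv; apply/asboolP => m.
have CZ (c : C) (w : C^o) : Cabs P (c *: w) <= Cabs P c * Cabs P w.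
  by rewrite -absvM.
exact: (@null_fps_submod C^o (Cabs P) a _ _ C0 (@absv_ultra R C (Cabs P)) CZ
  (hu m) (hv m)).
Qed.
HB.instance Definition _ :=
  GRing.isSubmodClosed.Build {poly F} HomCtt_t HomT_pred HomT_closed.

Record HomT : Type := HomTElt { HomT_val :> HomCtt_t; _ : HomT_val \in HomT_pred }.
HB.instance Definition _ := [isSub for HomT_val].
HB.instance Definition _ := [Choice of HomT by <:].
HB.instance Definition _ := [SubChoice_isSubLmodule of HomT by <:].

Definition pair_ser (m : tmotive E) (h : Eser) : fps C :=
  Fps (fun i => pt (KtoC P) m ((h : fps _) i)).

End Points.
End FunctionField.

(* Main.v *)
Require Import Defs.
From HB Require Import structures.
From mathcomp Require Import all_boot all_order all_algebra all_field.
From mathcomp Require Import mpoly.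
From mathcomp Require Import boolp classical_sets functions reals topology.
From mathcomp Require Import normedtype.

Import Order.TTheory Num.Theory.
Import GRing.Theory.
Local Open Scope ring_scope.

(** Additive F_q-linear polynomials in X_1, ..., X_d are K-combinations of the
    X_j ^ (q ^ k), so M is generated by the coordinates X_j as a left module over
    K{tau}.  A tau-equivariant K[t]-linear map mu is therefore determined by the
    series mu (X_j), which are the coordinates of a unique h in E[[t]] with
    mu (m) = m (h) for all m; the equation phi_t (h) = h t is t-linearity of mu on
    the X_j.  Convergence is compared on the X_j as well, since tau and
    K-linear combinations preserve null sequences. *)

(** * Exponents of F_q-linear polynomials in one variable *)

(** By Frobenius, [(X + 1) ^ (p ^ e * m)] equals [(X ^ (p ^ e) + 1) ^ m]; compare the coefficients
    of [X ^ (p ^ e)]. *)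
Lemma binomial_pfactor_pchar (L : fieldType) (p e m : nat) : p \in [pchar L] ->
  'C(p ^ e * m, p ^ e)%:R = m%:R :> L.
Proof.
move=> pL; have pp := pcharf_prime pL.
have e0 : (0 < p ^ e)%N by rewrite expn_gt0 prime_gt0.
pose B k : {poly L} := \poly_(i < k.+1) 'C(k, i)%:R.
have BE k : B k = ('X + 1) ^+ k.
  rewrite exprD1n /B poly_def; apply: eq_bigr => i _.
  by rewrite scaler_nat.
have BC k i : (B k)`_i = 'C(k, i)%:R.
  by rewrite coef_poly; case: ltnP => // ki; rewrite bin_small.
have BF : B (p ^ e * m)%N = B m \Po 'X^(p ^ e).
  rewrite !BE rmorphXn /= rmorphD rmorph1 /= comp_polyX exprM exprDn_pchar.
    by rewrite expr1n.
  by rewrite pnatX pnatE // pchar_poly pL.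
by rewrite -BC BF coef_comp_poly_Xn // dvdnn divnn e0 BC bin1.
Qed.

(** The inner variable ['X%:P] and the outer variable ['X] are independent. Taylor expansion gives
    the product in the conclusion as the coefficient of outer degree [i] and inner degree [n - i] on
    the left, while the right side has no mixed monomials. *)
Lemma additive_poly_coef (L : fieldType) (f : {poly L}) :
  (map_poly (polyC \o polyC) f).['X%:P + 'X] =
  (map_poly (polyC \o polyC) f).['X%:P] + (map_poly (polyC \o polyC) f).['X]
    :> {poly {poly L}} ->
  forall n i, (0 < i < n)%N -> f`_n * 'C(n, i)%:R = 0.
Proof.
move=> fD n i /andP[i0 ilt].
have [sn|nn] := leqP (size f) n; first by rewrite nth_default // mul0r.
have evX (g : {poly L}) : (map_poly (polyC \o polyC) g).['X%:P] = g%:P.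
  by rewrite map_poly_comp horner_map /= -/(_ \Po _) comp_polyXr.
move: fD; rewrite nderiv_taylor; last exact: mulrC.
rewrite size_map_inj_poly ?rmorph0 //; last first.
  by move=> x y /= /polyC_inj /polyC_inj.
rewrite evX map_poly_comp -[_.['X]]/(_ \Po 'X) comp_polyXr -map_poly_comp.
under eq_bigr do rewrite nderivn_map evX mul_polyC.
rewrite -(poly_def (size f) (fun j => f^`N(j))).
move=> /(congr1 (fun g : {poly {poly L}} => g`_i`_(n - i))).
rewrite coef_poly (ltn_trans ilt nn) coef_nderivn subnKC 1?ltnW // mulr_natr => ->.
by rewrite coefD coefC gtn_eqF // add0r coef_map coefC gtn_eqF // subn_gt0.
Qed.

(** For [s > 0] the nonzero polynomial ['X^(p ^ s) - 'X] would vanish on all of [F], which has more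
    elements than its degree. *)
Lemma expf_eq_id_card (F : finFieldType) (p s : nat) : p \in [pchar F] ->
  (p ^ s < #|F|)%N -> (forall c : F, c ^+ (p ^ s) = c) -> s = 0%N.
Proof.
move=> pF; case: s => // s sF cE; have p1 := prime_gt1 (pcharf_prime pF).
pose f : {poly F} := 'X^(p ^ s.+1) - 'X.
have q1 : (1 < p ^ s.+1)%N by rewrite -{1}(expn0 p) ltn_exp2l.
have sf : size f = (p ^ s.+1).+1.
  by rewrite size_polyDl ?size_polyXn // size_polyN size_polyX ltnS.
have f0 : f != 0 by rewrite -size_poly_gt0 sf.
have := max_poly_roots f0 _ (enum_uniq F).
rewrite -cardE sf ltnS leqNgt sF => /(_ _)/notF[].
by apply/allP => c _; rewrite rootE !hornerE cE subrr.
Qed.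

(* If [n = p ^ e * m] with [m > 1] prime to [p], additivity fails at
   [X ^ (p ^ e)], whose coefficient in [(X + 1) ^ n] is [m]; so [n = p ^ e],
   and then [c ^ n = c] for all [c] in [F] forces [n] to be a power of [q]. *)
Lemma Flinear_poly_coef (F : finFieldType) (L : fieldType)
    (iota : {rmorphism F -> L}) (f : {poly L}) :
  (map_poly (polyC \o polyC) f).['X%:P + 'X] =
  (map_poly (polyC \o polyC) f).['X%:P] + (map_poly (polyC \o polyC) f).['X]
    :> {poly {poly L}} ->
  (forall c : F, (map_poly polyC f).[(iota c) *: 'X] = iota c *: f) ->
  forall n, f`_n != 0 -> exists k, n = (#|F| ^ k)%N.
Proof.
move=> fD fZ n fn.
have [p p_pr pF] := finPcharP F.
have pL : p \in [pchar L] by rewrite (rmorph_pchar iota).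
have fC := @additive_poly_coef _ _ fD.
have cn (c : F) : c ^+ n = c.
  apply: (fmorph_inj iota); rewrite rmorphXn /=; apply: (mulfI fn).
  have /(congr1 (fun g : {poly L} => g`_n)) := fZ c.
  rewrite coefZ [iota c * _]mulrC => <-.
  rewrite -[_.[_]]/(f \Po _).
  have -> : f \Po (iota c *: 'X) = \poly_(i < size f) (f`_i * iota c ^+ i).
    rewrite poly_def comp_polyE; apply: eq_bigr => i _.
    by rewrite exprZn scalerA.
  by rewrite coef_poly; case: ltnP => // /(nth_default 0) ->; rewrite mul0r.
have n0 : (0 < n)%N.
  by rewrite lt0n; apply/eqP => n0; have := cn 0; rewrite n0 expr0 => /eqP; rewrite oner_eq0.
have [m pm nE] := pfactor_coprime p_pr n0.
have {pm}m1 : m = 1%N.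
  apply/eqP; apply: contraT => m1; case/negP: fn.
  have e0 : (0 < p ^ logn p n)%N by rewrite expn_gt0 prime_gt0.
  have mgt1 : (1 < m)%N.
    by rewrite ltn_neqAle eq_sym m1 lt0n; apply: contraTneq n0; rewrite nE => ->.
  have := fC n (p ^ logn p n)%N; rewrite e0 [X in (_ < X)%N]nE ltn_Pmull // => /(_ isT).
  rewrite {2}nE mulnC binomial_pfactor_pchar // => /eqP.
  rewrite mulf_eq0 => /orP[] // /eqP mL.
  by move: pm; rewrite prime_coprime // (dvdn_pcharf pL) mL eqxx.
move: nE; rewrite m1 mul1n; move: (logn p n) => e nE; subst n.
have qE := card_pprimeChar pF; move: qE.
set r := logn _ _; rewrite -[#|_|]/(#|F|) => qE.
exists (e %/ r)%N; rewrite qE -expnM.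
have r0 : (0 < r)%N.
  rewrite lt0n; apply/eqP => r0; have := finNzRing_gt1 F.
  by rewrite qE r0.
have cq (c : F) k : c ^+ (#|F| ^ k) = c.
  by elim: k => [|k IH]; rewrite ?expn0 ?expr1 // expnSr exprM IH expf_card.
(* Here [#|F| = p ^ r]. As raising to a power of [#|F|] is trivial on [F], the exponent [p ^ e] acts
   as [p ^ (e %% r)], which is below [#|F|], so root counting applies. *)
suff es : (e %% r = 0)%N by rewrite {1}(divn_eq e r) es addn0 mulnC.
apply: (@expf_eq_id_card F p) => // [|c].
  by rewrite qE ltn_exp2l ?prime_gt1 // ltn_pmod.
have -> : c ^+ (p ^ (e %% r)) = (c ^+ (#|F| ^ (e %/ r))) ^+ (p ^ (e %% r)).
  by rewrite cq.
by rewrite -exprM qE -expnM -expnD mulnC -divn_eq cn.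
Qed.

(** * Restriction to coordinate axes and generators of the motive *)

Lemma horner_pt (F : finFieldType) (K : fieldExtType {fraction {poly F}})
    (d : nat) (A : comNzRingType) (f : {rmorphism K -> A}) (m : {mpoly K[d]})
    (v : 'rV[{poly K}]_d) (a : A) :
  (map_poly f (pt (@polyC K) m v)).[a] =
  pt f m (\row_j (map_poly f (v 0 j)).[a]).
Proof.
rewrite /pt /mmap rmorph_sum horner_sum; apply: eq_bigr => w _.
rewrite rmorphM /= map_polyC hornerM hornerC /=; congr (_ * _).
rewrite /mmap1 rmorph_prod horner_prod; apply: eq_bigr => i _.
by rewrite rmorphXn horner_exp mxE.
Qed.

Section MotiveInduction.
Variables (F : finFieldType) (K : fieldExtType {fraction {poly F}}).
Variables (d : nat) (E : tmodule K d).

Lemma Ga_hom0 (m : {mpoly K[d]}) (A : comNzRingType) (f : {rmorphism K -> A}) :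
  Ga_hom m -> pt f m 0 = 0.
Proof. by case/(_ A f) => mD _; apply: (addrI (pt f m 0)); rewrite -mD !addr0. Qed.

(** The restriction of [m] to the [j]-th axis, read at the generic point of that axis;
    [horner_Ga_axis] specialises it to any algebra. *)
Definition Ga_axis (m : {mpoly K[d]}) (j : 'I_d) : {poly K} :=
  pt (@polyC K) m ('X *: delta_mx 0 j).

Lemma horner_Ga_axis (m : {mpoly K[d]}) (j : 'I_d)
    (A : comNzRingType) (f : {rmorphism K -> A}) (a : A) :
  (map_poly f (Ga_axis m j)).[a] = pt f m (a *: delta_mx 0 j).
Proof.
rewrite horner_pt; congr pt; apply/rowP => i; rewrite !mxE.
by rewrite rmorphM /= map_polyX rmorph_nat hornerM hornerX -[_%:R in LHS]polyC_natr hornerC.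
Qed.

(** The polynomial identities come from testing [Ga_hom] on universal points: over [{poly {poly K}}]
    for additivity and over [{poly K}] for the action of [F]. *)
Lemma Ga_axis_coef (m : {mpoly K[d]}) (j : 'I_d) (n : nat) : Ga_hom m ->
  (Ga_axis m j)`_n != 0 -> exists k, n = (#|F| ^ k)%N.
Proof.
move=> hm; apply: (Flinear_poly_coef _ _ (@FtoK F K)).
  rewrite !(horner_Ga_axis _ _ _ (polyC \o polyC)) scalerDl.
  by have [-> _] := hm _ (polyC \o polyC : {rmorphism K -> {poly {poly K}}}).
move=> c; rewrite horner_Ga_axis -!mul_polyC -scalerA.
by have [_ ->] := hm _ (@polyC K).
Qed.

(** [m] is its own value at the tautological point over [{mpoly K[d]}], whose coordinates are the
    variables; this point is a sum of points on the axes, and [m] is additive. *)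
Lemma Ga_hom_axis (m : {mpoly K[d]}) : Ga_hom m ->
  m = \sum_j (map_poly (@mpolyC d K) (Ga_axis m j)).['X_j].
Proof.
move=> hm; have [mD _] := hm _ (@mpolyC d K).
have m0 := @Ga_hom0 m _ (@mpolyC d K) hm.
under eq_bigr do rewrite horner_Ga_axis.
rewrite -(big_morph _ mD m0) -[LHS]comp_mpoly_id /comp_mpoly /pt.
apply: eq_bigr => w _; congr (_ * _); apply: mmap1_eq => i.
rewrite tnth_mktuple summxE (bigD1 i) //= big1 => [|j ji].
  by rewrite !mxE !eqxx mulr1 addr0.
by rewrite !mxE eqxx eq_sym (negPf ji) mulr0.
Qed.

Lemma Ga_homX (j : 'I_d) : Ga_hom ('X_j : {mpoly K[d]}).
Proof. by move=> A f; split=> [x y|c x]; rewrite /pt !mmapX !mmap1U mxE. Qed.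

Definition tmotiveX (j : 'I_d) : tmotive E :=
  TMotive E (tmotive_inP (Ga_homX j)).

Lemma pt_tmotiveX (j : 'I_d) (A : comNzRingType) (f : {rmorphism K -> A}) x :
  pt f (tmotiveX j) x = x 0 j.
Proof. by rewrite /pt mmapX mmap1U. Qed.

(* [Hom (G_a^d, G_a)] is generated by the coordinates as a left module over the
   twisted polynomial ring [K{tau}]. *)
Lemma tmotive_ind (Q : tmotive E -> Prop) :
  Q 0 -> (forall c m n, Q m -> Q n -> Q (c%:P *: m + n)) ->
  (forall m, Q m -> Q (tmotive_tau m)) -> (forall j, Q (tmotiveX j)) ->
  forall m, Q m.
Proof.
move=> Q0 QD Qtau QX m.
(* The individual terms of the axis decomposition are bare polynomials, so [Q] is transported to
   these. *)
pose S (p : {mpoly K[d]}) := exists2 n : tmotive E, tmotive_val n = p & Q n.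
have SD p p' : S p -> S p' -> S (p + p').
  move=> [n <- Qn] [n' <- Qn']; exists (n + n') => //.
  by rewrite -[n]scale1r -[1]/(1%:P); apply: QD.
have S0 : S 0 by exists 0.
suff [n /val_inj <-] : S m by [].
have S_term j (c : K) i :
    (c != 0 -> exists k, i = (#|F| ^ k)%N) -> S (c%:MP * 'X_j ^+ i).
  have [-> _|c0 /(_ isT)[k ->]] := eqVneq c 0; first by rewrite mpolyC0 mul0r.
  (* This power is the [k]-fold [tmotive_tau] of [tmotiveX j]. *)
  have [n nE Qn] : S ('X_j ^+ (#|F| ^ k)).
    elim: k => [|k [n nE Qn]]; first by exists (tmotiveX j).
    by exists (tmotive_tau n); [rewrite /= nE -exprM expnSr | apply: Qtau].
  exists (c%:P *: n + 0); last exact: QD.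
  by rewrite addr0 [_ *: n]tmotive_scaleC /= nE mul_mpolyC.
rewrite (Ga_hom_axis _ (tmotiveP m)).
apply: (big_ind S) => // j _; rewrite horner_coef.
apply: (big_ind S) => // i _; rewrite coef_map.
exact/S_term/Ga_axis_coef/tmotiveP.
Qed.
End MotiveInduction.
Arguments tmotiveX {F K d} E j.

(** * The pairing of the motive with formal series *)

Section Pairing.
Variables (R : realType) (F : finFieldType).
Variables (K : fieldExtType {fraction {poly F}}) (P : infinite_place K R).
Variables (d : nat) (E : tmodule K d).
Local Notation C := (Cinf P).

Lemma fps_of_polyX (A : comNzRingType) : fps_of_poly ('X : {poly A}) = fps_t A.
Proof. by apply: fpsP => i /=; rewrite coefX. Qed.

Lemma fps_of_polyC_mul (A : comNzRingType) (c : A) (x : fps A) n :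
  (fps_of_poly c%:P * x) n = c * x n.
Proof.
rewrite fpsME big_ord_recl /= coefC eqxx subn0 big1 ?addr0 // => i _.
by rewrite coefC mul0r.
Qed.

Lemma KtToCttD (f g : {poly K}) : KtToCtt P (f + g) = KtToCtt P f + KtToCtt P g.
Proof. by rewrite /KtToCtt !rmorphD. Qed.

Lemma KtToCttM (f g : {poly K}) : KtToCtt P (f * g) = KtToCtt P f * KtToCtt P g.
Proof. by rewrite /KtToCtt !rmorphM. Qed.

Lemma KtToCttX : KtToCtt P 'X = fps_t C.
Proof. by rewrite /KtToCtt map_polyX fps_of_polyX. Qed.

Lemma KtToCttC_mul (c : K) (x : fps C) n :
  (KtToCtt P c%:P * x) n = KtoC P c * x n.
Proof. by rewrite /KtToCtt map_polyC fps_of_polyC_mul. Qed.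

Lemma pair_serD (m n : tmotive E) (h : Eser P d) :
  pair_ser (m + n) h = pair_ser m h + pair_ser n h.
Proof. by apply: fpsP => i; rewrite /= /pt mmapD. Qed.

Lemma pair_ser0 (h : Eser P d) : pair_ser (0 : tmotive E) h = 0.
Proof. by apply: fpsP => i; rewrite /= /pt mmap0. Qed.

Lemma pair_serC (c : K) (m : tmotive E) (h : Eser P d) :
  pair_ser (c%:P *: m) h = KtToCtt P c%:P * pair_ser m h.
Proof.
apply: fpsP => i; rewrite KtToCttC_mul [_ *: m]tmotive_scaleC /=.
by rewrite /pt mmapZ.
Qed.

Lemma pair_ser_tau (m : tmotive E) (h : Eser P d) :
  pair_ser (tmotive_tau m) h = tau_ser (pair_ser m h).
Proof. by apply: fpsP => i; rewrite /= /pt rmorphXn. Qed.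

Lemma tmotive_scaleX (m : tmotive E) : 'X *: m = tmotive_comp 'X m.
Proof.
rewrite -[X in X *: _]mul1r [LHS]tmotive_scaleMX; congr tmotive_comp.
exact: tmotive_scale1.
Qed.

Lemma pair_serX (m : tmotive E) (h : Eser P d) :
  pair_ser ('X *: m) h = pair_ser m (phi_ser E 'X h).
Proof. by apply: fpsP => i; rewrite tmotive_scaleX /= pt_comp. Qed.

Lemma pair_ser_shift (m : tmotive E) (h : Eser P d) :
  pair_ser m (fps_t F *: h) = fps_t C * pair_ser m h.
Proof.
have tE : FttoCtt P (fps_t F) = fps_t C.
  by apply: fpsP => i; exact: (rmorph_nat (FtoC P)). 
apply: fpsP => n.
rewrite -[LHS]/(pt _ m ((FttoCtt P (fps_t F) *: (h : fps 'rV[C]_d)) n)) tE.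
rewrite -[RHS]/((fps_t C *: (pair_ser m h : fps C^o)) n) !fps_tZE.
(* In degree 0 the shift gives the zero point, which [m] sends to 0. *)
by case: n => [|n] //; exact/Ga_hom0/tmotiveP.
Qed.

Lemma pair_ser_tmotiveX (j : 'I_d) (h : Eser P d) i :
  pair_ser (tmotiveX E j) h i = (h : fps _) i 0 j.
Proof. exact: pt_tmotiveX. Qed.

Lemma pair_ser_inj (h h' : Eser P d) :
  (forall j, pair_ser (tmotiveX E j) h = pair_ser (tmotiveX E j) h') -> h = h'.
Proof.
move=> eh; apply: fpsP => i; apply/rowP => j.
by rewrite -!pair_ser_tmotiveX eh.
Qed.

(** Membership in [Hhat] serves for the factor ['X]: it turns composition with [phi E 'X] into the
    shift of [h]. *)
Lemma pair_ser_linear (h : Eser P d) : h \in Hhat_pred E ->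
  forall (f : {poly K}) (m1 m2 : tmotive E),
  pair_ser (f *: m1 + m2) h = KtToCtt P f * pair_ser m1 h + pair_ser m2 h.
Proof.
move=> /asboolP hh f m1 m2; rewrite pair_serD; congr (_ + _).
elim/poly_ind: f => [|f c IH]; first by rewrite scale0r pair_ser0 /KtToCtt !rmorph0 mul0r.
rewrite scalerDl pair_serD pair_serC KtToCttD mulrDl; congr (_ + _).
rewrite mulrC -scalerA pair_serX hh pair_ser_shift IH KtToCttM KtToCttX.
by rewrite mulrA.
Qed.

Lemma pair_serZ (m : tmotive E) (a : fps F) (h1 h2 : Eser P d) :
  pair_ser m (a *: h1 + h2) = FttoCtt P a * pair_ser m h1 + pair_ser m h2.
Proof.
have [mD mZ] := tmotiveP m (KtoC P).
apply: fpsP => n.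
rewrite -[LHS]/(pt _ m ((a *: h1 : fps 'rV[C]_d) n + (h2 : fps _) n)) mD.
rewrite fpsDE; congr (_ + _).
rewrite EserZE fpsME (big_morph _ mD (Ga_hom0 _ _ _ _ _ (KtoC P) (tmotiveP m))).
by apply: eq_bigr => i _; rewrite mZ.
Qed.

Lemma pair_ser_HomCtt (h : Hhat P E) :
  (fun m : tmotive E => pair_ser m (Hhat_val h) : Ctt P) \in @HomCtt_pred F K R P d E.
Proof.
apply/asboolP; split; last by move=> m; exact: pair_ser_tau.
exact/pair_ser_linear/(valP h).
Qed.

Definition hom_of_ser (h : Hhat P E) : HomCtt P E :=
  HomCttElt (pair_ser_HomCtt h).

Fact hom_of_ser_linear : linear hom_of_ser.
Proof.
by move=> a h1 h2; apply: val_inj; apply: funext => m; apply: pair_serZ.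
Qed.
HB.instance Definition _ := GRing.isLinear.Build (fps F) (Hhat P E)
  (HomCtt P E) _ hom_of_ser hom_of_ser_linear.

(** * Recovering the series from a homomorphism *)

Lemma HomCtt0 (mu : HomCtt P E) : HomCtt_val mu 0 = 0.
Proof.
have /asboolP[/(_ (-1) 0 0) + _] := valP mu.
by rewrite scaler0 add0r /KtToCtt !rmorphN1 mulN1r addNr.
Qed.

Lemma HomCttZ (mu : HomCtt P E) (f : {poly K}) (m : tmotive E) :
  HomCtt_val mu (f *: m) = KtToCtt P f * (HomCtt_val mu m : fps C).
Proof.
have /asboolP[/(_ f m 0) + _] := valP mu.
by rewrite addr0 [X in _ + X]HomCtt0 addr0.
Qed.

(** Both sides respect sums, constants of [K] and [tau], so [tmotive_ind] reduces to coordinates.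
    This holds for any series [h], which lets [ser_of_hom_in] derive the equation of [Hhat]
    afterwards. *)
Lemma HomCtt_pair_ser (mu : HomCtt P E) (h : Eser P d) :
  (forall j, HomCtt_val mu (tmotiveX E j) = pair_ser (tmotiveX E j) h) ->
  forall m, HomCtt_val mu m = pair_ser m h.
Proof.
move=> e m; have /asboolP[muD mut] : HomCtt_val mu \in @HomCtt_pred F K R P d E := valP mu.
elim/tmotive_ind: m => [|c m n Em En|m Em|//].
- by rewrite HomCtt0 pair_ser0.
- by rewrite muD Em En pair_serD pair_serC.
by rewrite mut Em pair_ser_tau.
Qed.

Definition ser_of_hom (mu : HomCtt P E) : Eser P d :=
  Fps (fun i => \row_j (HomCtt_val mu (tmotiveX E j) : fps C) i).

Lemma ser_of_homK (mu : HomCtt P E) m :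
  HomCtt_val mu m = pair_ser m (ser_of_hom mu).
Proof.
apply: HomCtt_pair_ser => j; apply: fpsP => i.
by rewrite pair_ser_tmotiveX mxE.
Qed.

(** Paired with each coordinate, the equation becomes compatibility of [mu] with multiplication by
    ['X]; the coordinates separate series. *)
Lemma ser_of_hom_in (mu : HomCtt P E) : ser_of_hom mu \in Hhat_pred E.
Proof.
apply/asboolP/pair_ser_inj => j.
rewrite -pair_serX pair_ser_shift -!ser_of_homK -KtToCttX.
exact: HomCttZ.
Qed.

Lemma hom_of_ser_bij : bijective hom_of_ser.
Proof.
exists (fun mu => HhatElt (ser_of_hom_in mu)) => [h|mu].
  by apply/val_inj/pair_ser_inj => j /=; rewrite -ser_of_homK.
by apply: val_inj; apply: funext => m; rewrite /= -ser_of_homK.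
Qed.

(** * Comparison of convergence *)

Lemma absv_exp_le1 (x : C) n : Cabs P x <= 1 -> Cabs P (x ^+ n) <= 1.
Proof.
move=> x1; elim: n => [|n IH]; last by rewrite exprS absvM mulr_ile1 ?absv_ge0.
(* The base case is |1| = 1, which follows from |1| |1| = |1| and |1| nonzero. *)
have /eqP := absvM (Cabs P) 1 1; rewrite mulr1 -[X in X == _]mulr1.
have a1 : Cabs P 1 != 0 by apply/eqP => /absv_eq0/eqP; rewrite oner_eq0.
by rewrite (inj_eq (mulfI a1)) eq_sym => /eqP->.
Qed.

Lemma Tate_add (x y : fps C) : Tate x -> Tate y -> Tate (x + y).
Proof.
have C0 := @absv_ge0 R C (Cabs P).
move=> /(null_fpsP _ C0) hx /(null_fpsP _ C0) hy.
apply/(null_fpsP _ C0) => e e0.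
have [n1 h1] := hx e e0; have [n2 h2] := hy e e0.
exists (maxn n1 n2) => n; rewrite geq_max => /andP[/h1 ? /h2 ?].
by rewrite (le_lt_trans (absv_ultra _ _ _)) // gt_max; apply/andP.
Qed.

Lemma pair_ser_Tate (m : tmotive E) (h : Eser P d) :
  null_fps (@supnorm F K R P d) h -> Tate (pair_ser m h).
Proof.
have C0 := @absv_ge0 R C (Cabs P).
have a0 : Cabs P 0 = 0 by apply/absv_eq0.
move=> /(null_fpsP _ (@supnorm_ge0 _ _ _ P d)) hh.
elim/tmotive_ind: m => [|c m n Tm Tn|m Tm|j].
- rewrite pair_ser0; apply/(null_fpsP _ C0) => e e0.
  by exists 0%N => n _; rewrite a0.
- rewrite pair_serD; apply: Tate_add => //; rewrite pair_serC.
  move/(null_fpsP _ C0): Tm => hm; apply/(null_fpsP _ C0) => e e0.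
  (* Adding 1 keeps the divisor positive when [c] is 0. *)
  have c0 : 0 < Cabs P (KtoC P c) + 1 by rewrite ltr_wpDl // absv_ge0.
  have [n0 hn] := hm _ (divr_gt0 e0 c0); exists n0 => i /hn.
  rewrite KtToCttC_mul absvM ltr_pdivlMr //; apply: le_lt_trans.
  by rewrite mulrC ler_wpM2l // lerDl.
- rewrite pair_ser_tau.
  move/(null_fpsP _ C0): Tm => hm; apply/(null_fpsP _ C0) => e e0.
  (* The bound 1 ensures that the remaining [#|F|.-1] factors do not increase the absolute value. *)
  have e1 : 0 < Num.min e 1 by rewrite lt_min e0 ltr01.
  have [n0 hn] := hm _ e1; exists n0 => i /hn; rewrite lt_min => /andP[le l1].
  have -> : tau_ser (pair_ser m h) i =
      pair_ser m h i * pair_ser m h i ^+ #|F|.-1.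
    by rewrite -exprS prednK // ltnW // finNzRing_gt1.
  rewrite absvM.
  by rewrite (le_lt_trans _ le) // ler_piMr // absv_exp_le1 // ltW.
apply/(null_fpsP _ C0) => e e0; have [n0 hn] := hh e e0.
exists n0 => i /hn; apply: le_lt_trans.
rewrite pair_ser_tmotiveX; exact: le_bigmax.
Qed.

Lemma Tate_supnorm (h : Eser P d) :
  (forall j, Tate (pair_ser (tmotiveX E j) h)) ->
  null_fps (@supnorm F K R P d) h.
Proof.
have C0 := @absv_ge0 R C (Cabs P).
move=> hT; apply/(null_fpsP _ (@supnorm_ge0 _ _ _ P d)) => e e0.
have hj j : exists n0, forall i, (n0 <= i)%N -> Cabs P ((h : fps _) i 0 j) < e.
  have /(null_fpsP _ C0)/(_ e e0)[n0 hn] := hT j.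
  by exists n0 => i /hn; rewrite pair_ser_tmotiveX.
(* Finitely many coordinates admit a common threshold. *)
have [N hN] := choice hj; exists (\max_j N j) => i hi.
apply: bigmax_lt => // j _; apply: hN.
exact: leq_trans (leq_bigmax j) hi.
Qed.

Lemma HomT_hom_of_ser (h : H P E) : hom_of_ser (H_val h) \in @HomT_pred F K R P d E.
Proof. by apply/asboolP => m; apply/pair_ser_Tate/asboolP/(valP h). Qed.

Definition homT_of_ser (h : H P E) : HomT P E := HomTElt (HomT_hom_of_ser h).

Fact homT_of_ser_linear : linear homT_of_ser.
Proof.
by move=> a h1 h2; apply: val_inj; apply: (linearP hom_of_ser).
Qed.
HB.instance Definition _ := GRing.isLinear.Build {poly F} (H P E)
  (HomT P E) _ homT_of_ser homT_of_ser_linear.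

(** The inverse [g] of [hom_of_ser] restricts: Tate values of [mu] on the coordinates force the
    series [g mu] to be null, by [Tate_supnorm]. *)
Lemma homT_of_ser_bij : bijective homT_of_ser.
Proof.
have [g gK Kg] := hom_of_ser_bij.
have gH (mu : HomT P E) : (g (HomT_val mu) : Hhat_t P E) \in @H_pred F K R P d E.
  apply/asboolP/Tate_supnorm => j.
  have /asboolP/(_ (tmotiveX E j)) := valP mu.
  suff -> : pair_ser (tmotiveX E j) (g (HomT_val mu)) =
      HomCtt_val (HomT_val mu) (tmotiveX E j) by [].
  by rewrite -{2}(Kg (HomT_val mu)).
exists (fun mu => HElt (gH mu)) => [h|mu]; apply: val_inj => /=.
  exact: gK.
exact: Kg.
Qed.
End Pairing.

Theorem theorem3p9 (R : realType) (F : finFieldType)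
    (K : fieldExtType {fraction {poly F}}) (P : infinite_place K R)
    (d : nat) (E : tmodule K d) :
  exists (Phi : {linear Hhat P E -> HomCtt P E})
         (iota : {linear H P E -> HomT P E}),
    [/\ forall (h : Hhat P E) (m : tmotive E), Phi h m = pair_ser m h,
        bijective Phi,
        forall h : H P E, HomT_val (iota h) = Phi (H_val h)
      & bijective iota].
Proof.
exists (@hom_of_ser R F K P d E), (@homT_of_ser R F K P d E); split=> //.
- exact: hom_of_ser_bij.
- exact: homT_of_ser_bij.
Qed.
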